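(* For every $n\ge 1$, the six bistatistics $(\mathsf{des}_2,\mathsf{ear})$, $(\mathsf{ear},\mathsf{des}_2)$, $(\mathsf{des}_2,\mathsf{pdrop})$, $(\mathsf{pdrop},\mathsf{des}_2)$, $(\mathsf{des}_2,\mathsf{pcyc})$, $(\mathsf{pcyc},\mathsf{des}_2)$ are equidistributed on $\mathfrak{S}_n$; that is, the polynomial $\sum_{\pi\in\mathfrak{S}_n}q^{\mathsf{st}_1(\pi)}t^{\mathsf{st}_2(\pi)}$ is the same for each of these six pairs $(\mathsf{st}_1,\mathsf{st}_2)$.
   Context: $\mathfrak{S}_n$ is the set of permutations of $[n]=\{1,\dots,n\}$. For $\pi\in\mathfrak{S}_n$ and an index $i\in[n]$: $i$ is a descent if $i<n$ and $\pi(i)>\pi(i+1)$; $i$ is a record if $\pi(j)<\pi(i)$ for all $j<i$; $i$ is an antirecord if $\pi(j)>\pi(i)$ for all $j>i$; $i$ is a descent of type $2$ if it is both a descent and a record; $i$ is a cycle peak if $\pi(i)<i>\pi^{-1}(i)$; $i$ is an exclusive antirecord cycle peak if $i$ is a cycle peak and an antirecord but not a record; $i$ is a pure drop if $\pi(i)<i$ and $\pi(j)\notin[\pi(i),i]$ for every $j>i$, where $[a,b]=\{k\mid a\le k\le b\}$. A cycle of $\pi$ is pure if it contains at least two elements. $\mathsf{des}_2(\pi)$, $\mathsf{ear}(\pi)$, $\mathsf{pdrop}(\pi)$, $\mathsf{pcyc}(\pi)$ denote respectively the numbers of descents of type $2$, exclusive antirecord cycle peaks, pure drops, and pure cycles of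 $\pi$. *)

(* Defs.v *)
From mathcomp Require Import all_boot all_order all_fingroup all_algebra.

Set Implicit Arguments.
Unset Strict Implicit.
Unset Printing Implicit Defensive.

Import GRing.Theory.

(* The set [n] = {1, ..., n} is represented by 'I_n = {0, ..., n-1} through    *)
(* the shift i |-> i - 1; the notions below only compare positions and values, *)
(* so they are unaffected by this shift.                                       *)

Definition descent (n : nat) (s : 'S_n) (i : 'I_n) : bool :=
  [exists j : 'I_n, (j == i.+1 :> nat) && (s j < s i)].

Definition record (n : nat) (s : 'S_n) (i : 'I_n) : bool :=
  [forall j : 'I_n, (j < i) ==> (s j < s i)].

Definition antirecord (n : nat) (s : 'S_n) (i : 'I_n) : bool :=
  [forall j : 'I_n, (i < j) ==> (s i < s j)].

Definition descent2 (n : nat) (s : 'S_n) (i : 'I_n) : bool := descent s i && record s i.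

Definition cycle_peak (n : nat) (s : 'S_n) (i : 'I_n) : bool := (s i < i) && ((s^-1)%g i < i).

Definition excl_antirecord_cycle_peak (n : nat) (s : 'S_n) (i : 'I_n) : bool :=
  [&& cycle_peak s i, antirecord s i & ~~ record s i].

Definition pure_drop (n : nat) (s : 'S_n) (i : 'I_n) : bool :=
  (s i < i) && [forall j : 'I_n, (i < j) ==> ~~ (s i <= s j <= i)].

Definition des2 (n : nat) (s : 'S_n) : nat := #|[set i | descent2 s i]|.
Definition ear (n : nat) (s : 'S_n) : nat := #|[set i | excl_antirecord_cycle_peak s i]|.
Definition pdrop (n : nat) (s : 'S_n) : nat := #|[set i | pure_drop s i]|.
Definition pcyc (n : nat) (s : 'S_n) : nat := #|[set c in porbits s | 1 < #|c|]|.

Local Open Scope ring_scope.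

(* \sum_(s in S_n) q^(st1 s) t^(st2 s) as an element of Z[q][t]: q is the inner *)
(* variable 'X%:P and t is the outer variable 'X.                               *)
Definition bistat_poly (n : nat) (st1 st2 : 'S_n -> nat) : {poly {poly int}} :=
  \sum_(s : 'S_n) ('X%:P) ^+ st1 s * 'X^(st2 s).

(* Main.v *)
Require Import Defs.
From mathcomp Require Import all_boot all_order all_fingroup all_algebra.
From mathcomp Require Import ring zify.

(** Fix the weak excedances of [s]; they determine [des2 s].  Read the remaining
positions [i] (the drops) from left to right: each picks a value among those
smaller than [i] that are still unused.  At a cycle peak exactly one of the
available values makes [i] count for [ear] (the smallest), for [pdrop] (the
largest), for [pcyc] (the one closing the cycle), so the three statistics have
the same distribution given the weak excedances.

For the symmetry, read [s] from right to left, keeping the number [k] of open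
positions and a bit telling whether the last position was an excedance record:
[des2] counts the excedance records [i] such that [i + 1] is not one, and [pcyc]
the [i] that are minimal in a nontrivial cycle.  With [p = 1 - x], [r = 1 - t],
let [Q_k], [P_k] be the generating functions in [z] of the completions from the
state [k] with bit 1, 0, so that [P_k = Q_k - p z (Q_k + Q_{k-1})].  If [Lam] is
the linear functional [u^k |-> Q_k] and [eta = u - p z (1 + u)], then
[Y_k = Lam (eta^k)] obeys
[Y_k = z ((k+t) Y_{k+1} + (2k+1) Y_k + (k-1+x) Y_{k-1} - p r z Y_k)], which becomes
symmetric in [x] and [t] after rescaling [Y_k] by [t (t+1) ... (t+k-1)]; and
[Y_0 = Q_0] is the generating function of the bistatistic. *)

Set Implicit Arguments.
Unset Strict Implicit.
Unset Printing Implicit Defensive.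

Import GRing.Theory.

(** * Cycles and their extremal elements *)

Section CycleExtremum.
Variables (T : finType).
Implicit Types (s : {perm T}) (A : pred T).

(* Follows [s] from [x] for as long as the next point lies in [A]; #|T| steps always suffice. *)
Definition path_end s A (x : T) : T := iter #|T| (fun y => if A (s y) then s y else y) x.

Lemma path_endP s A x : ~~ A x ->
  exists d, [/\ path_end s A x = iter d s x, ~~ A (s (path_end s A x))
                & forall j, 0 < j <= d -> A (iter j s x)].
Proof.
move=> Ax.
have ex : exists k, ~~ A (iter k.+1 s x).
  exists #|porbit s x|.-1; rewrite prednK ?iter_porbit // lt0n; exact: card_porbit_neq0.
pose d := ex_minn ex.
have [Ad dmin] : ~~ A (iter d.+1 s x) /\ forall j, 0 < j <= d -> A (iter j s x).
  rewrite /d; case: ex_minnP => k Ak kmin; split=> // [[//|j]] /= jk.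
  by apply: contraTT jk => /kmin; rewrite -leqNgt.
have dT : d <= #|T|.
  rewrite /d; case: ex_minnP => k _ kmin; apply: leq_trans (max_card (mem (porbit s x))).
  apply: leq_trans (kmin #|porbit s x|.-1 _) (leq_pred _).
  by rewrite prednK ?iter_porbit // lt0n card_porbit_neq0.
suff E : path_end s A x = iter d s x by exists d; rewrite E; split.
have Emin k : iter k (fun y => if A (s y) then s y else y) x = iter (minn k d) s x.
  elim: k => [|k IH]; first by rewrite min0n.
  rewrite iterS IH; case: (leqP d k) => [dk|kd].
    by rewrite (minn_idPr (leqW dk)) -iterS (negPf Ad).
  by rewrite (minn_idPl kd) -iterS dmin.
by rewrite /path_end Emin (minn_idPr dT).
Qed.

(** Leaving [A] at [x] itself means that the walk has gone once round the whole cycle. *)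
Lemma path_end_cycle s A x : ~~ A x ->
  (s (path_end s A x) == x) = [forall y in porbit s x, (y == x) || A y].
Proof.
move=> Ax; have [d [Ed Aend dA]] := path_endP s Ax.
apply/eqP/forall_inP => [ex y | h].
  rewrite porbit_traject => /trajectP[j _ ->].
  have ed : iter d.+1 s x = x by rewrite iterS -Ed.
  have -> : iter j s x = iter (j %% d.+1) s x.
    rewrite {1}(divn_eq j d.+1) addnC iterD; congr (iter _ _ _).
    by elim: (j %/ d.+1) => // q IH; rewrite mulSn iterD IH.
  have := ltn_pmod j (ltn0Sn d); case: (j %% d.+1) => [|i] hi; first by rewrite eqxx.
  by rewrite dA ?orbT //=.
apply/eqP; move: (h (s (path_end s A x))); rewrite (negPf Aend) orbF; apply.
by rewrite Ed -iterS -permX mem_porbit.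
Qed.

Lemma card_porbit_gt1 s x : (1 < #|porbit s x|) = (s x != x).
Proof.
have [e|ne] := eqVneq (s x) x; last first.
  by apply/card_gt1P; exists (s x), x; rewrite porbit_id -{1}(expg1 s) mem_porbit.
apply/negbTE; rewrite -leqNgt; apply/card_le1P => y; rewrite porbit_traject => /trajectP[j _ ->] z.
have E k : iter k s x = x by elim: k => //= k ->.
rewrite E porbit_traject !inE; apply/trajectP/eqP => [[k _ ->]//|->].
by exists 0; rewrite ?lt0n ?card_porbit_neq0.
Qed.

(** Each pure cycle is counted at its element of largest [f]. With [f] the value this is its largest
    element, with an order-reversing [f] its smallest. *)
Lemma card_pure_cycles s (f : T -> nat) : injective f ->
  #|[set c in porbits s | 1 < #|c|]| =
  #|[set m | (s m != m) && [forall y in porbit s m, (y == m) || (f y < f m)]]|.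
Proof.
move=> f_inj; set B := [set m | (s m != m) && _].
suff -> : [set c in porbits s | 1 < #|c|] = porbit s @: B.
  apply: card_in_imset => m m'; rewrite !inE => /andP[_ /forall_inP h] /andP[_ /forall_inP h'] e.
  have : m' \in porbit s m by rewrite e porbit_id.
  have : m \in porbit s m' by rewrite -e porbit_id.
  by move/h'/predU1P => [//|lt1] /h/predU1P[//|lt2]; move: (ltn_trans lt1 lt2); rewrite ltnn.
apply/setP => c; rewrite inE; apply/andP/imsetP => [[/imsetP[x _ ->] cgt1]|[m]].
  have [m mx mmax] := arg_maxnP f (porbit_id s x); exists m; last first.
    by apply/eqP; rewrite eq_porbit_mem porbit_sym.
  have e : porbit s m = porbit s x by apply/eqP; rewrite eq_porbit_mem.
  rewrite inE -card_porbit_gt1 e cgt1; apply/forall_inP => y /mmax.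
  by rewrite /geq /= leq_eqVlt (inj_eq f_inj).
by rewrite inE => /andP[sm _] ->; rewrite imset_f // card_porbit_gt1.
Qed.

End CycleExtremum.

(** * Drops filled from left to right *)

Section ExcedancePart.
Variable n : nat.
Implicit Types (s : 'S_n) (i j v : 'I_n).

Lemma card_lt_ord k : k <= n -> #|[set j : 'I_n | j < k]| = k.
Proof.
move=> kn; rewrite -sum1_card (eq_bigl (fun j : 'I_n => j < k)) => [|j]; last by rewrite inE.
by rewrite (big_ord_narrow kn) sum1_card card_ord.
Qed.

Lemma perm_prefix_bound s k v : k <= n -> (forall j, j < k -> s j <= v) -> k <= v.+1.
Proof.
move=> kn h; rewrite -{1}(card_lt_ord kn) -(card_lt_ord (ltn_ord v)) -(card_imset _ (@perm_inj _ s)).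
by apply/subset_leq_card/subsetP => _ /imsetP[j + ->]; rewrite !inE ltnS; apply: h.
Qed.

Lemma record_weak_exc s i : record s i -> i <= s i.
Proof.
move/forallP=> h; rewrite -ltnS; apply: (@perm_prefix_bound s) (ltn_ord i) _ => j.
by rewrite ltnS leq_eqVlt => /predU1P[/val_inj ->//|]; have := h j => /implyP /[apply] /ltnW.
Qed.

Definition exc_part s : {ffun 'I_n -> option 'I_n} :=
  [ffun i : 'I_n => if i <= s i then Some (s i) else None].

Lemma exc_part_eq s s' i : exc_part s = exc_part s' -> i <= s i -> s' i = s i.
Proof. by move/ffunP/(_ i); rewrite !ffunE => + h; rewrite h; case: ifP => // _ [->]. Qed.

Lemma exc_part_le s s' i : exc_part s = exc_part s' -> (i <= s i) = (i <= s' i).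
Proof.
by move=> e; apply/idP/idP => h; [rewrite (exc_part_eq e h) | rewrite (exc_part_eq (esym e) h)].
Qed.

Lemma exc_part_cycle_peak s s' i : exc_part s = exc_part s' -> cycle_peak s i = cycle_peak s' i.
Proof.
move=> e; congr andb; first by rewrite !ltnNge (exc_part_le i e).
wlog suff : s s' e / (s^-1)%g i < i -> (s'^-1)%g i < i.
  by move=> H; apply/idP/idP; apply: H.
move=> h; have <- : (s^-1)%g i = (s'^-1)%g i => //.
by apply: (@perm_inj _ s'); rewrite permKV (exc_part_eq e) permKV // ltnW.
Qed.

(** A record is a weak excedance. A drop at [i + 1] or before [i] then takes a value below [s i],
    whichever it is, so the weak excedances decide. *)
Lemma exc_part_descent2 s s' i : exc_part s = exc_part s' -> descent2 s i = descent2 s' i.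
Proof.
move=> e; wlog suff : s s' e / descent2 s i -> descent2 s' i.
  by move=> H; apply/idP/idP; apply: H.
case/andP=> /existsP[j /andP[/eqP ji lt_ji]] rec_i.
have le_i := record_weak_exc rec_i; have si := exc_part_eq e le_i.
apply/andP; split.
  apply/existsP; exists j; rewrite ji eqxx si /=.
  case: (leqP j (s j)) => [jj|]; first by rewrite (exc_part_eq e jj).
  rewrite ltnNge (exc_part_le j e) -ltnNge ji ltnS => h.
  case: (ltngtP (s' j) (s i)) => //; first by lia.
  by rewrite -si => /val_inj/perm_inj; move: ji => /[swap] ->; lia.
apply/forallP => k; apply/implyP => ki; rewrite si.
case: (leqP k (s k)) => [kk|].
  by rewrite (exc_part_eq e kk); move/forallP/(_ k): rec_i; rewrite ki.
by rewrite ltnNge (exc_part_le k e); lia.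
Qed.

Lemma exc_part_des2 s s' : exc_part s = exc_part s' -> des2 s = des2 s'.
Proof. by move=> e; apply: eq_card => i; rewrite !inE (exc_part_descent2 _ e). Qed.

Definition avail s i : {set 'I_n} := [set v : 'I_n | (v < i) && (i <= (s^-1)%g v)].

(** Values below [i] coming from positions at or after [i] are as many as positions before [i] sent
    to values at or above [i]; the latter are excedances, visible in [exc_part]. *)
Lemma exc_part_card_avail s s' i : exc_part s = exc_part s' -> #|avail s i| = #|avail s' i|.
Proof.
move=> e; suff H u : #|avail u i| = #|[set j : 'I_n | j < i & i <= u j]|.
  rewrite !H; apply: eq_card => j; rewrite !inE; case: ltnP => //= ji.
  apply/idP/idP => h; [rewrite (exc_part_eq e) // | rewrite (exc_part_eq (esym e)) //];
  exact: leq_trans (ltnW ji) h.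
pose A := [set j : 'I_n | j < i]; pose B := u @^-1: A.
have cAB : #|A| = #|B| by rewrite card_preimset //; apply: perm_inj.
have -> : [set j : 'I_n | j < i & i <= u j] = A :\: B.
  by apply/setP => j; rewrite !inE -leqNgt andbC.
have -> : #|avail u i| = #|B :\: A|.
  rewrite -(card_preimset _ (@perm_inj _ u)); apply: eq_card => j.
  by rewrite !inE permK -leqNgt andbC.
by rewrite !cardsD setIC cAB.
Qed.

Definition agree m s s' := [forall j : 'I_n, (j < m) ==> (s' j == s j)].

Lemma agreeP m s s' : reflect (forall j, j < m -> s' j = s j) (agree m s s').
Proof. by apply: (iffP forallP) => h j; [move/(implyP (h j))/eqP | apply/implyP => /h ->]. Qed.

Lemma agree_sym m s s' : agree m s s' -> agree m s' s.
Proof. by move/agreeP=> h; apply/agreeP => j /h ->. Qed.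

Lemma agree_inv m s s' v : agree m s s' -> (s^-1)%g v < m -> (s'^-1)%g v = (s^-1)%g v.
Proof. by move/agreeP=> h hv; apply: (@perm_inj _ s'); rewrite permKV h // permKV. Qed.

Lemma agree_avail s s' i : agree i s s' -> avail s i = avail s' i.
Proof.
move=> h; apply/setP => v; rewrite !inE; case: (v < i) => //=.
rewrite !(leqNgt i); congr negb; apply/idP/idP => hv; first by rewrite (agree_inv h).
by rewrite (agree_inv (agree_sym h)).
Qed.

End ExcedancePart.

(** * Product formula for the fillings with given weak excedances *)

Section DropFillings.
Local Open Scope ring_scope.
Variables (n : nat) (R : comNzRingType) (t : R).
Implicit Types (s : 'S_n) (i j v : 'I_n).

Definition drop_weight s i : R :=
  if (s i < i)%N then (if cycle_peak s i then #|avail s i|%:R - 1 + t else #|avail s i|%:R) else 1.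

(** The marked value, giving a factor [t] when a cycle peak [i] takes it. It may depend only on the
    values left of [i], so that it is known when position [i] is filled. *)
Variable choice : 'S_n -> 'I_n -> 'I_n.
Hypothesis choice_avail : forall s i, cycle_peak s i -> choice s i \in avail s i.
Hypothesis choice_agree : forall s s' i, agree i s s' -> choice s' i = choice s i.

Definition hits s : nat := #|[set i | cycle_peak s i && (s i == choice s i)]|.

Let wt s i : R := if cycle_peak s i && (s i == choice s i) then t else 1.
Let drop_weight_exc s s' i : exc_part s = exc_part s' -> drop_weight s i = drop_weight s' i.
Proof.
by move=> e; rewrite /drop_weight (exc_part_cycle_peak i e) (exc_part_card_avail i e) !ltnNge (exc_part_le i e).
Qed.

Let prod_ge_recl (F : 'I_n -> R) i :
  \prod_(j : 'I_n | (i <= j)%N) F j = F i * \prod_(j : 'I_n | (i.+1 <= j)%N) F j.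
Proof.
by rewrite (bigD1 i) //=; congr (_ * _); apply: eq_bigl => j; rewrite andbC ltn_neqAle eq_sym.
Qed.

Let same_class m s s' := (exc_part s' == exc_part s) && agree m s s'.

(* [s1] is [s] with the values at positions [i] and [s^-1 v >= i] exchanged; both remain drops. *)
Let same_classS s i v : (s i < i)%N -> v \in avail s i ->
  exists2 s1, exc_part s1 = exc_part s & forall s', same_class i s s' && (s' i == v) = same_class i.+1 s1 s'.
Proof.
move=> si; rewrite inE => /andP[vi iv].
pose s1 := (s * tperm (s i) v)%g.
have s1i : s1 i = v by rewrite permM tpermL.
have s1D j : j != i -> s j != v -> s1 j = s j.
  by move=> ji jv; rewrite permM tpermD // eq_sym // (inj_eq perm_inj).
have e1 : exc_part s1 = exc_part s.
  apply/ffunP => j; rewrite !ffunE.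
  have [->|ji] := eqVneq j i; first by rewrite s1i !(leqNgt i) si vi.
  have [jv|jv] := eqVneq (s j) v; last by rewrite s1D.
  have ij : (i <= j)%N by rewrite -jv permK in iv.
  rewrite permM jv tpermR !(leqNgt j) (leq_trans vi ij) (leq_trans si ij) //.
have a1 : agree i s s1.
  apply/agreeP => j ji; apply: s1D; first by rewrite -val_eqE /= ltn_eqF.
  by apply: contraTneq ji => jv; rewrite -jv permK in iv; rewrite -leqNgt.
exists s1 => // s'; rewrite /same_class e1 -andbA; congr andb.
apply/andP/agreeP => [[/agreeP h /eqP si' j]|h].
  by rewrite ltnS leq_eqVlt => /predU1P[/val_inj ->|ji]; rewrite ?si' ?s1i // h // (agreeP _ _ _ a1).
split; last by rewrite h // s1i.
by apply/agreeP => j ji; rewrite h 1?ltnW // (agreeP _ _ _ a1).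
Qed.

(** Induction on the number of positions not yet filled: a weak excedance at [m] is forced, while a
    drop ranges over [avail], with one marked value at a cycle peak. *)
Lemma sum_drop_fillings m s :
  \sum_(s' | same_class m s s') \prod_(i : 'I_n | (m <= i)%N) wt s' i =
  \prod_(i : 'I_n | (m <= i)%N) drop_weight s i.
Proof.
have [d] := ubnP (n - m); elim: d m s => // d IH m s; rewrite ltnS => nmd.
case: (leqP n m) => [nm|mn].
  have none (i : 'I_n) : (m <= i)%N = false by rewrite leqNgt (leq_trans (ltn_ord i) nm).
  rewrite [RHS]big_pred0 // (big_pred1 s) => [|s']; first by rewrite big_pred0.
  apply/andP/eqP => [[_ /agreeP h]|->]; last by split=> //; apply/agreeP.
  by apply/permP => j; apply/h/(leq_trans (ltn_ord j)).
have [i im] : exists i : 'I_n, i = m :> nat by exists (Ordinal mn).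
rewrite -{}im {mn} in nmd *; rewrite prod_ge_recl.
have {}IH : forall s, \sum_(s' | same_class i.+1 s s') \prod_(j : 'I_n | (i.+1 <= j)%N) wt s' j
    = \prod_(j : 'I_n | (i.+1 <= j)%N) drop_weight s j.
  by move=> s1; apply: IH; move: (ltn_ord i); lia.
under eq_bigr do rewrite (prod_ge_recl _ i).
case: (leqP i (s i)) => si.
  have nodrop s' : exc_part s' = exc_part s -> (s' i < i)%N = false.
    by move=> e; rewrite ltnNge (exc_part_le i e) si.
  rewrite {1}/drop_weight nodrop // mul1r -IH; apply: eq_big => [s'|s' /andP[/eqP e _]]; last first.
    by rewrite /wt /cycle_peak nodrop // mul1r.
  rewrite /same_class; case: eqP => //= e; apply/agreeP/agreeP => h j; last by move/ltnW/h.
  rewrite ltnS leq_eqVlt => /predU1P[ji|/h//].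
  by rewrite (val_inj ji) (exc_part_eq (esym e)).
rewrite (partition_big (fun s' => s' i) (mem (avail s i))) /=; last first.
  move=> s' /andP[/eqP e a]; rewrite (agree_avail a) inE permK leqnn andbT.
  by rewrite ltnNge (exc_part_le i e) -ltnNge.
transitivity (\sum_(v in avail s i)
   (if cycle_peak s i && (v == choice s i) then t else 1) * \prod_(j : 'I_n | (i.+1 <= j)%N) drop_weight s j).
  (* [s1] represents the fillings with value [v] at [i]; its [exc_part] is that of [s], so all later
     factors [drop_weight] are the same. *)
  apply: eq_bigr => v av; have [s1 e1 E1] := same_classS si av.
  rewrite (eq_bigr _ (fun j _ => drop_weight_exc j (esym e1))) -IH mulr_sumr.
  rewrite (eq_bigl _ _ E1); apply: eq_bigr => s'; rewrite -E1 => /andP[/andP[/eqP e a] /eqP si'].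
  by rewrite {1}/wt (exc_part_cycle_peak i e) (choice_agree a) si'.
rewrite -mulr_suml; congr (_ * _); rewrite /drop_weight si; case: ifP => pk /=; last by rewrite sumr_const.
rewrite (bigD1 (choice s i)) ?choice_avail //= eqxx addrC; congr (_ + _).
rewrite (eq_bigr (fun=> 1)) => [|v /andP[_ /negPf ->]//].
rewrite sumr_const (cardD1 (choice s i) (avail s i)) choice_avail // natrD addrAC subrr add0r.
congr (_ *+ _); apply: eq_card => v; by rewrite !inE andbC unfold_in inE.
Qed.

Lemma sum_hits s : \sum_(s' | exc_part s' == exc_part s) t ^+ hits s' = \prod_i drop_weight s i.
Proof.
have := sum_drop_fillings 0 s; rewrite (eq_bigl (fun s' => exc_part s' == exc_part s)); last first.
  by move=> s'; rewrite /same_class; case: eqP => //= _; apply/agreeP.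
move=> <-; apply: eq_bigr => s' _.
by rewrite /wt -big_mkcond prodr_const /hits; congr (_ ^+ _); apply: eq_card => i; rewrite inE.
Qed.

End DropFillings.

(** * The statistics [ear], [pdrop] and [pcyc] as numbers of marked choices *)

Section Choices.
Local Open Scope ring_scope.
Variables (n : nat) (R : comNzRingType) (x t : R).
Implicit Types (s : 'S_n) (i j v : 'I_n).

Definition admissible (c : 'S_n -> 'I_n -> 'I_n) :=
  (forall s i, cycle_peak s i -> c s i \in avail s i) /\
  (forall s s' i, agree i s s' -> c s' i = c s i).

(** On a class of equal [exc_part], [des2] is constant and the sum of [t ^+ hits] is a product of
    factors [drop_weight], in which the choice does not occur. *)
Lemma des2_hits_indep c1 c2 : admissible c1 -> admissible c2 ->
  \sum_(s : 'S_n) x ^+ des2 s * t ^+ hits c1 s = \sum_(s : 'S_n) x ^+ des2 s * t ^+ hits c2 s.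
Proof.
move=> [av1 ag1] [av2 ag2]; rewrite !(partition_big_imset (@exc_part n)) /=.
apply: eq_bigr => _ /imsetP[s _ ->].
transitivity (x ^+ des2 s * \prod_i drop_weight t s i).
  rewrite -(sum_hits t av1 ag1) mulr_sumr; apply: eq_big => // s' /eqP e.
  by rewrite (exc_part_des2 e).
rewrite -(sum_hits t av2 ag2) mulr_sumr; apply: eq_big => // s' /eqP e.
by rewrite (exc_part_des2 e).
Qed.

Lemma avail_self s i : (s i < i)%N -> s i \in avail s i.
Proof. by move=> si; rewrite inE si permK /=. Qed.

(** [le] is [leq] for the least available value and [geq] for the greatest. With these orders the
    default [i] is never reached at a drop, where [s i] is available. *)
Definition extremal_choice (le : rel nat) s i : 'I_n :=
  odflt i [pick v in avail s i | [forall w in avail s i, le v w]].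

Lemma extremal_choiceP (le : rel nat) s i : reflexive le -> transitive le -> total le ->
  (s i < i)%N -> extremal_choice le s i \in avail s i /\
    (forall w, w \in avail s i -> le (extremal_choice le s i) w).
Proof.
move=> le_refl le_trans le_total si; rewrite /extremal_choice; case: pickP => /= [v /andP[-> /forall_inP]//|].
have [v av vm] := @extremumP _ _ le _ (mem (avail s i)) val le_refl le_trans le_total (avail_self si).
by move/(_ v); rewrite [v \in _]av => /negbT/forall_inP[]; apply: vm.
Qed.

Lemma extremal_choice_eq (le : rel nat) s i : reflexive le -> transitive le -> total le -> antisymmetric le ->
  (s i < i)%N -> (s i == extremal_choice le s i) = [forall w in avail s i, le (s i) w].
Proof.
move=> le_refl le_trans le_total le_anti si.
have [ac cm] := extremal_choiceP le_refl le_trans le_total si.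
apply/eqP/forall_inP => [-> //|h]; apply: val_inj; apply: le_anti.
by rewrite (h _ ac) (cm _ (avail_self si)).
Qed.

Lemma extremal_admissible (le : rel nat) : reflexive le -> transitive le -> total le ->
  admissible (extremal_choice le).
Proof.
move=> le_refl le_trans le_total; split=> [s i /andP[si _]|s s' i a].
  by have [] := extremal_choiceP le_refl le_trans le_total si.
by rewrite /extremal_choice (agree_avail a).
Qed.

Lemma geq_refl : reflexive geq. Proof. exact: leqnn. Qed.
Lemma geq_trans : transitive geq. Proof. by move=> a b c /= ba ac; apply: leq_trans ac ba. Qed.
Lemma geq_total : total geq. Proof. by move=> a b; apply: leq_total. Qed.
Lemma geq_anti : antisymmetric geq. Proof. by move=> a b /= ab; apply: anti_leq; rewrite andbC. Qed.

Lemma ear_hits s : ear s = hits (extremal_choice leq) s.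
Proof.
apply: eq_card => i; rewrite !inE /excl_antirecord_cycle_peak.
case: (boolP (cycle_peak s i)) => //= /andP[si _].
rewrite (extremal_choice_eq leqnn leq_trans leq_total anti_leq si).
have -> : ~~ record s i by apply: contraL si => /record_weak_exc; rewrite -leqNgt.
rewrite andbT; apply/forallP/forall_inP => [h w|h j].
  rewrite inE => /andP[_]; rewrite leq_eqVlt => /predU1P[/val_inj ->|]; first by rewrite permKV.
  by move/(implyP (h _)); rewrite permKV => /ltnW.
apply/implyP => ij; case: (ltnP (s j) i) => [sj|]; last exact: leq_trans.
rewrite ltn_neqAle h ?inE ?sj ?permK ?(ltnW ij) // andbT.
by apply: contraTneq ij => /val_inj/perm_inj ->; rewrite ltnn.
Qed.

(** A pure drop is a cycle peak: otherwise the value [i] would sit to the right of position [i],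
    inside the forbidden interval. *)
Lemma pdrop_hits s : pdrop s = hits (extremal_choice geq) s.
Proof.
apply: eq_card => i; rewrite !inE /pure_drop /cycle_peak.
case: (ltnP (s i) i) => //= si.
rewrite (extremal_choice_eq geq_refl geq_trans geq_total geq_anti si).
apply/forallP/andP => [h|[pk /forall_inP h] j].
  have pk : ((s^-1)%g i < i)%N.
    rewrite ltnNge leq_eqVlt; apply/negP => /predU1P[/val_inj e|].
      by move: si; rewrite {1}e permKV ltnn.
    by move/(implyP (h _)); rewrite permKV leqnn andbT ltnW.
  split=> //; apply/forall_inP => w; rewrite inE => /andP[wi]; rewrite leq_eqVlt.
  case/predU1P => [/val_inj ->|]; first by rewrite permKV /=.
  by move/(implyP (h _)); rewrite permKV (ltnW wi) andbT -ltnNge => /ltnW.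
apply/implyP => ij; apply/negP => /andP[lo hi].
have sj : (s j < i)%N.
  rewrite ltn_neqAle hi andbT; apply: contraTneq pk => /val_inj e.
  by rewrite -{1}e permK -leqNgt ltnW.
have := h (s j); rewrite inE sj permK (ltnW ij) => /(_ isT) /= ji.
have /perm_inj e : s j = s i by apply/val_inj/anti_leq; rewrite lo ji.
by move: ij; rewrite e ltnn.
Qed.

(** Goes back along the cycle from [i] through points below [i]. The end of this walk is known
    before position [i] is filled, and taking it as the value at [i] closes a cycle with largest
    element [i]. *)
Definition closing_choice s i : 'I_n := path_end (s^-1)%g (fun y : 'I_n => (y < i)%N) i.

Lemma closing_admissible : admissible closing_choice.
Proof.
split=> [s i /andP[_ pk]|s s' i a].
  have ii : ~~ (i < i)%N by rewrite ltnn.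
  rewrite inE /closing_choice; have [d [-> ]] := path_endP (s^-1)%g (A := fun y : 'I_n => (y < i)%N) ii.
  case: d => [|d]; first by rewrite /= pk.
  by rewrite -leqNgt => -> /(_ d.+1) -> //=.
rewrite /closing_choice /path_end; apply: eq_iter => y.
case: ltnP => [h|h]; first by rewrite (agree_inv (agree_sym a) h) h.
by case: ltnP => // h'; move: h; rewrite (agree_inv a h') leqNgt h'.
Qed.

Lemma pcyc_hits s : pcyc s = hits closing_choice s.
Proof.
rewrite /pcyc (card_pure_cycles s val_inj); apply: eq_card => i; rewrite !inE.
have ii : ~~ (i < i)%N by rewrite ltnn.
have := path_end_cycle (s^-1)%g (A := fun y : 'I_n => (y < i)%N) ii.
rewrite porbitV -/(closing_choice s i) (canF_eq (permKV s)) eq_sym => ->.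
case: (boolP [forall _ in _, _]) => [/forall_inP h|]; rewrite ?andbF // !andbT.
apply/idP/idP => [si|/andP[si _]]; last by apply: contraTneq si => ->; rewrite ltnn.
have := h (s i); rewrite -{1}(expg1 s) mem_porbit (negPf si) => /(_ isT) /= lt1.
have := h ((s^-1)%g i); rewrite -porbitV -{1}(expg1 s^-1) mem_porbit => /(_ isT).
case/predU1P => [e|lt2]; last by rewrite /cycle_peak lt1.
by rewrite -{1}e permKV eqxx in si.
Qed.

End Choices.

(** * The symmetric recurrence *)

Section Truncation.
Local Open Scope ring_scope.
Variables (R : comNzRingType) (N : nat).

(** Being zero modulo ['X^(N+1)]. Power series in z are represented by truncated polynomials, so
    their identities become congruences. *)
Definition vanishes (a : {poly R}) := forall m, (m <= N)%N -> a`_m = 0.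

Lemma vanishes0 : vanishes 0.
Proof. by move=> m _; rewrite coef0. Qed.

Lemma vanishesD a b : vanishes a -> vanishes b -> vanishes (a + b).
Proof. by move=> ha hb m hm; rewrite coefD ha ?hb ?addr0. Qed.

Lemma vanishesN a : vanishes a -> vanishes (- a).
Proof. by move=> ha m hm; rewrite coefN ha ?oppr0. Qed.

Lemma vanishesB a b : vanishes a -> vanishes b -> vanishes (a - b).
Proof. by move=> ha hb; apply: vanishesD => //; apply: vanishesN. Qed.

Lemma vanishesM a b : vanishes b -> vanishes (a * b).
Proof.
move=> hb m hm; rewrite coefM big1 // => i _; rewrite hb ?mulr0 //.
exact: leq_trans (leq_subr _ _) hm.
Qed.

Lemma vanishes_sum (I : finType) (F : I -> {poly R}) :
  (forall i, vanishes (F i)) -> vanishes (\sum_i F i).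
Proof. by move=> hF; apply: big_ind => //; [apply: vanishes0 | apply: vanishesD]. Qed.

End Truncation.

Section Recurrence.
Local Open Scope ring_scope.
Variable R : comNzRingType.

(* [trans_count x t b k m] counts the completions over the [m] lowest positions and
   values when [k] higher positions and values are open and [b] is the excedance
   record bit; in [path_count] the weights of the closing steps are moved to the
   opening steps. *)
Fixpoint trans_count (x t : R) (b : bool) (k m : nat) : R :=
  if m is m'.+1 then
    let U := trans_count x t in
    U false k.+1 m' + k.+1%:R * U false k m' +
    (if k is k'.+1 then
       (if b then 1 else x) * (U true k m' + (k'%:R + t) * U true k' m') +
       k'%:R * (U false k m' + (k'%:R + t) * U false k' m')
     else 0)
  else (k == 0%N)%:R.

Fixpoint path_count (x t : R) (b : bool) (k m : nat) : R :=
  if m is m'.+1 then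
    let U := path_count x t in
    (k%:R + t) * U false k.+1 m' + k.+1%:R * U false k m' +
    (if k is k'.+1 then
       (if b then 1 else x) * (U true k m' + U true k' m') +
       k'%:R * (U false k m' + U false k' m')
     else 0)
  else (k == 0%N)%:R.

Definition rising (t : R) (k : nat) : R := \prod_(i < k) (i%:R + t).

Lemma risingS t k : rising t k.+1 = rising t k * (k%:R + t).
Proof. by rewrite /rising big_ord_recr. Qed.

(** On a path from level [k] to level 0, each level below [k] is entered from above once more than
    it is left upwards; the surplus factors make up [rising t k]. *)
Lemma trans_count_scale x t b k m : trans_count x t b k m = rising t k * path_count x t b k m.
Proof.
elim: m b k => [|m IH] b k /=.
  by case: k => [|k]; rewrite ?mulr0 ///rising big_ord0 mul1r.
case: k => [|k]; rewrite !IH !risingS; last by ring.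
by rewrite /rising big_ord0; ring.
Qed.

(** * From the series [Q] to the moments of [eta] *)

Section Series.
Variables (x t : R) (N : nat).
Local Notation "a ≡ b" := (vanishes N (a - b)) (at level 70).
Let z : {poly R} := 'X.
Let p : {poly R} := (1 - x)%:P.
Let Q k : {poly R} := \poly_(m < N.+1) path_count x t true k m.
Let P k : {poly R} := \poly_(m < N.+1) path_count x t false k m.

(** The variable u is the outer ['X]; the coefficients are polynomials in [z], the inner ['X]. *)
Let Lam (f : {poly {poly R}}) : {poly R} := \sum_(i < size f) f`_i * Q i.

Let LamE n (f : {poly {poly R}}) : (size f <= n)%N -> Lam f = \sum_(i < n) f`_i * Q i.
Proof.
move=> hn; rewrite /Lam -!(big_mkord xpredT (fun i => f`_i * Q i)).
rewrite [RHS](big_cat_nat (leq0n _) hn) /= [X in _ + X]big1_seq ?addr0 // => i.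
by rewrite mem_index_iota => /andP[_ /andP[hi _]]; rewrite nth_default ?mul0r.
Qed.

Let LamD f g : Lam (f + g) = Lam f + Lam g.
Proof.
pose n := maxn (size f) (size g).
rewrite !(@LamE n) ?leq_maxl ?leq_maxr //; last by rewrite size_polyD.
by rewrite -big_split /=; apply: eq_bigr => i _; rewrite coefD mulrDl.
Qed.

Let LamZ a f : Lam (a%:P * f) = a * Lam f.
Proof.
rewrite !(@LamE (size f)) //; last by rewrite mul_polyC size_scale_leq.
by rewrite mulr_sumr; apply: eq_bigr => i _; rewrite coefCM mulrA.
Qed.

Let LamXn k : Lam 'X^k = Q k.
Proof.
rewrite (@LamE k.+1) ?size_polyXn // (bigD1 ord_max) //= big1 ?addr0.
  by rewrite coefXn eqxx mul1r.
by move=> i hi; rewrite coefXn -[k]/(val (@ord_max k)) val_eqE (negPf hi) mul0r.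
Qed.

Let eta : {poly {poly R}} := 'X - (p * z)%:P * (1 + 'X).

(** The bit matters only in the step with an excedance record, whose weight is [x] in place of 1. *)
Let PQ k : P k.+1 ≡ Q k.+1 - p * z * (Q k.+1 + Q k).
Proof.
move=> m hm; rewrite /P /Q /p /z !(coefN, coefD) -mulrA coefCM coefXM coefD !coef_poly ltnS hm.
case: m hm => [|m] hm /=; first by ring.
by rewrite !ltnS (ltnW hm); ring.
Qed.

Let Q0 : Q 0 ≡ 1 + z * (t%:P * P 1 + Q 0).
Proof.
move=> m hm; rewrite /P /Q /p /z !(coefN, coefD) coefXM coefD coefCM !coef_poly ltnS hm coef1.
case: m hm => [|m] hm /=; first by ring.
rewrite !ltnS (ltnW hm).
have -> : path_count x t true 0 m = path_count x t false 0 m by case: m {hm}.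
by ring.
Qed.

(** In [k.+1%:R *+ 2], a share [k + 2] comes from the steps without excedance and [k] from the
    excedances that are not records. *)
Let QS k : Q k.+1 ≡ z * ((k.+1%:R + t%:P) * P k.+2 + (k.+1%:R *+ 2) * P k.+1 + k%:R * P k + Q k.+1 + Q k).
Proof.
move=> m hm; rewrite /P /Q /p /z !(coefN, coefD) coefXM -!polyC_natr -polyCMn -polyCD.
rewrite !(coefD, coefCM) !coef_poly ltnS hm.
case: m hm => [|m] hm /=; first by ring.
by rewrite !ltnS (ltnW hm); ring.
Qed.

(** By [PQ] the right side is congruent to [P k.+1], so multiplication by [eta] passes from bit 1 to
    bit 0 one level up. *)
Let LamEta k : Lam (eta * 'X^k) = Q k.+1 - p * z * (Q k.+1 + Q k).
Proof.
have -> : eta * 'X^k = 'X^(k.+1) + (- (p * z))%:P * ('X^(k.+1) + 'X^k).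
  by rewrite /eta polyCN exprS; ring.
by rewrite !(LamD, LamZ, LamXn); ring.
Qed.

(* On [h = 'X^k] the vanishing of [err] is the recurrence of [Q], see [err_Xn];
   by linearity it can then be used on [h = eta ^+ k]. *)
Let step (h : {poly {poly R}}) : {poly {poly R}} :=
  eta * ((1 + 'X) ^+ 2 * h^`() + (1 + t%:P)%:P * 'X * h + 2%:P * h) + (1 + 'X) * h.

Let err h := Lam ('X * h) - z * Lam (step h).

Let stepD f g : step (f + g) = step f + step g.
Proof. by rewrite /step derivD; ring. Qed.

Let stepC a f : step (a%:P * f) = a%:P * step f.
Proof. by rewrite /step derivM derivC; ring. Qed.

Let errD f g : err (f + g) = err f + err g.
Proof. by rewrite /err stepD mulrDr !LamD; ring. Qed.

Let errC a f : err (a%:P * f) = a * err f.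
Proof. by rewrite /err stepC mulrCA !LamZ; ring. Qed.

Let err0 : err 0 = 0.
Proof. by rewrite -[0 in LHS](mul0r 0) -polyC0 errC mul0r. Qed.

Let err_Xn k : vanishes N (err 'X^k).
Proof.
have DP j : vanishes N (P j.+1 - Lam (eta * 'X^j)) by rewrite LamEta; apply: PQ.
rewrite /err -exprS LamXn.
(* At [k = 0] the recurrence [QS] contains [P 0], which [DP] does not cover, but with coefficient
   0. *)
case: k => [|k].
  have -> : step 'X^0 = (1 + t%:P)%:P * (eta * 'X^1) + 2%:P * (eta * 'X^0) + 'X^0 + 'X^1.
    by rewrite /step expr0 derivC; ring.
  rewrite !(LamD, LamZ, LamXn).
  rewrite (_ : _ - _ = (Q 1 - z * ((1 + t%:P) * P 2 + (1 *+ 2) * P 1 + 0 * P 0 + Q 1 + Q 0))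
    + z * (1 + t%:P) * (P 2 - Lam (eta * 'X^1)) + z * 2 * (P 1 - Lam (eta * 'X^0))); last by ring.
  by apply: vanishesD; [apply: vanishesD; [exact: (QS 0)|]|]; apply: vanishesM.
have -> : step 'X^(k.+1) = k.+1%:R%:P * (eta * 'X^k) + (2 * k.+1%:R + 2)%:P * (eta * 'X^(k.+1))
   + (k.+1%:R + 1 + t%:P)%:P * (eta * 'X^(k.+2)) + 'X^(k.+1) + 'X^(k.+2).
  by rewrite /step derivXn /= !exprS -mulr_natl !(polyCD, polyCM, polyC_natr, polyC1); ring.
rewrite !(LamD, LamZ, LamXn).
rewrite (_ : _ - _ = (Q k.+2 - z * ((k.+2%:R + t%:P) * P k.+3 + (k.+2%:R *+ 2) * P k.+2 + k.+1%:R * P k.+1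
        + Q k.+2 + Q k.+1))
    + z * (k.+2%:R + t%:P) * (P k.+3 - Lam (eta * 'X^(k.+2)))
    + z * (k.+2%:R *+ 2) * (P k.+2 - Lam (eta * 'X^(k.+1)))
    + z * k.+1%:R * (P k.+1 - Lam (eta * 'X^k))); last by ring.
by do 3?[apply: vanishesD; last by apply: vanishesM]; exact: (QS k.+1).
Qed.

Let err_vanishes h : vanishes N (err h).
Proof.
rewrite -(coefK h) poly_def (big_morph err errD err0).
by apply: vanishes_sum => i; rewrite -mul_polyC errC; apply: vanishesM.
Qed.

Let Y k := Lam (eta ^+ k).

Let Y_rec k : Y k.+1 ≡ z * ((k.+1%:R + t%:P) * Y k.+2 + (2 * k%:R + 3) * Y k.+1 + (k%:R + x%:P) * Y k
   - (1 - x)%:P * (1 - t)%:P * z * Y k.+1).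
Proof.
(* Multiplying by [1 - p * z] turns [1 + 'X] into [1 + eta] and ['X] into [eta + p * z], so only
   powers of [eta] remain; the stray [p * z] lowers the coefficient [k + 1] of [Y k] to [k + x]. *)
have := @vanishesM _ N (1 - p * z) _ (err_vanishes (eta ^+ k)).
congr vanishes; rewrite /err mulrBr [_ * (z * _)]mulrCA -!LamZ.
have -> : (1 - p * z)%:P * ('X * eta ^+ k) = eta ^+ k.+1 + (p * z)%:P * eta ^+ k.
  by rewrite exprS /eta polyCB; ring.
have -> : (1 - p * z)%:P * step (eta ^+ k) =
   (k%:R + 1)%:P * eta ^+ k + (2 * k%:R + (1 + t%:P) * (p * z) + 2 * (1 - p * z) + 1)%:P * eta ^+ k.+1
   + (k%:R + 1 + t%:P)%:P * eta ^+ k.+2.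
  have e1 : (1 - p * z)%:P * (1 + 'X) = 1 + eta by rewrite /eta polyCB; ring.
  have e2 : (1 - p * z)%:P * 'X = eta + (p * z)%:P by rewrite /eta polyCB; ring.
  (* The derivative [1 - p * z] of [eta] is the second such factor, needed by the square of
     [1 + 'X]. *)
  have e3 : (eta ^+ k)^`() * eta = (1 - p * z)%:P * eta ^+ k *+ k.
    rewrite deriv_exp; case: k => [|k]; rewrite ?mulr0n ?mul0r //.
    rewrite /= exprS mulrnAl; congr (_ *+ _).
    by rewrite /eta !(derivE, derivM, derivC) polyCB; ring.
  rewrite /step.
  transitivity ((1 - p * z)%:P * (1 + 'X) ^+ 2 * ((eta ^+ k)^`() * eta)
     + (1 + t%:P)%:P * eta * eta ^+ k * ((1 - p * z)%:P * 'X) + 2%:P * eta * eta ^+ k * (1 - p * z)%:P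
     + ((1 - p * z)%:P * (1 + 'X)) * eta ^+ k); first by ring.
  rewrite e3 e1 e2 -mulr_natl.
  transitivity (k%:R * (((1 - p * z)%:P * (1 + 'X)) ^+ 2) * eta ^+ k
     + (1 + t%:P)%:P * eta * eta ^+ k * (eta + (p * z)%:P) + 2%:P * eta * eta ^+ k * (1 - p * z)%:P
     + (1 + eta) * eta ^+ k); first by ring.
  by rewrite e1 !exprS !(polyCD, polyCM, polyCB, polyC_natr, polyC1); ring.
by rewrite !(LamD, LamZ) -!/(Y _) /p !polyCB; ring.
Qed.

Let Y0_rec : Y 0 ≡ 1 + z * (t%:P * Y 1 + Y 0).
Proof.
have e0 : Y 0 = Q 0 by rewrite /Y expr0 -(expr0 'X) LamXn.
have e1 : vanishes N (P 1 - Y 1) by rewrite /Y expr1 -[eta]mulr1 -(expr0 'X) LamEta; apply: PQ.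
rewrite e0 (_ : _ - _ = (Q 0 - (1 + z * (t%:P * P 1 + Q 0))) + (z * t%:P) * (P 1 - Y 1)); last by ring.
by apply: vanishesD (vanishesM _ e1).
Qed.

(** The scaling turns the outer coefficients of [Y_rec] into 1 and [(k + x) (k + t)], symmetric in
    [x] and [t]. *)
Definition scaled_moment k : {poly R} := (rising t k)%:P * Y k.

Lemma scaled_moment0 m : (m <= N)%N -> (scaled_moment 0)`_m = path_count x t true 0 m.
Proof.
move=> hm; rewrite /scaled_moment /rising big_ord0 mul1r /Y expr0 -(expr0 'X) LamXn.
by rewrite coef_poly ltnS hm.
Qed.

Lemma scaled_moment_rec0 : scaled_moment 0 ≡ 1 + 'X * (scaled_moment 1 + scaled_moment 0).
Proof.
move: Y0_rec; congr vanishes.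
by rewrite /scaled_moment risingS /rising big_ord0 /z !polyCM polyCD polyC0; ring.
Qed.

Lemma scaled_moment_rec k :
  scaled_moment k.+1 ≡ 'X * (scaled_moment k.+2 + (2 * k%:R + 3) * scaled_moment k.+1
    + (k%:R + x%:P) * (k%:R + t%:P) * scaled_moment k - (1 - x)%:P * (1 - t)%:P * 'X * scaled_moment k.+1).
Proof.
move: (vanishesM (rising t k.+1)%:P (Y_rec k)); congr vanishes.
rewrite /scaled_moment !risingS /z !(polyCM, polyCD) !polyC_natr; ring.
Qed.

End Series.

(** The difference of the two families of moments obeys a homogeneous recurrence whose right side
    carries a factor ['X], so its coefficients vanish by induction on the degree, for all [k] at
    once. *)
Lemma path_count_sym x t n : path_count x t true 0 n = path_count t x true 0 n.
Proof.
rewrite -!(@scaled_moment0 _ _ n) //; apply/eqP; rewrite -subr_eq0; apply/eqP; rewrite -coefB.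
pose D k := scaled_moment x t n k - scaled_moment t x n k.
have D0 : vanishes n (D 0%N - 'X * (D 1%N + D 0%N)).
  have := vanishesB (@scaled_moment_rec0 x t n) (@scaled_moment_rec0 t x n).
  by congr vanishes; rewrite /D; ring.
have DS k : vanishes n (D k.+1 - 'X * (D k.+2 + (2 * k%:R + 3) * D k.+1
    + (k%:R + x%:P) * (k%:R + t%:P) * D k - (1 - x)%:P * (1 - t)%:P * 'X * D k.+1)).
  have := vanishesB (@scaled_moment_rec x t n k) (@scaled_moment_rec t x n k).
  by congr vanishes; rewrite /D; ring.
suff H m k : (m <= n)%N -> (D k)`_m = 0 by exact: H.
clearbody D; elim/ltn_ind: m k => m IH k hm.
have Dz j m' : (m' < m)%N -> (D j)`_m' = 0 by move=> h; apply: IH => //; apply: leq_trans (ltnW h) hm.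
have Dm a j m' : (m' < m)%N -> (a * D j)`_m' = 0.
  by move=> h; rewrite coefM big1 // => i _; rewrite Dz ?mulr0 // (leq_ltn_trans (leq_subr _ _)).
case: k => [|k]; [move: (D0 m hm) | move: (DS k m hm)]; rewrite coefB coefXM.
  by case: m {hm IH} Dz Dm => [|m] Dz Dm /=; rewrite ?subr0 // coefD !(Dz _ m) // addr0 subr0.
case: m {hm IH} Dz Dm => [|m] Dz Dm /=; rewrite ?subr0 //.
by rewrite !(coefN, coefD) !(Dm _ _ m) // (Dz _ m) // !(addr0, oppr0).
Qed.

End Recurrence.

(** * The right-to-left recurrence *)

Section ExcRecord.
Variable n : nat.
Implicit Types (s : 'S_n) (i j v w : 'I_n).

(** Indexed by a natural number so that [i + 1] is allowed at the last position; the value at [n] is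
    false. *)
Definition exc_record s (m : nat) : bool := [exists i : 'I_n, [&& i == m :> nat, record s i & i < s i]].

Lemma exc_recordE s i : exc_record s i = record s i && (i < s i).
Proof.
apply/existsP/idP => [[j /andP[/eqP/val_inj -> //]]|h].
by exists i; rewrite eqxx.
Qed.

Lemma exc_record_last s : exc_record s n = false.
Proof. by apply/existsP => -[i /andP[/eqP e _]]; move: (ltn_ord i); rewrite e ltnn. Qed.

(** If [i] is an excedance record but not a descent, then [s (i + 1) > s i >= i + 1] and [i + 1] is
    an excedance record too. *)
Lemma descent2E s i : descent2 s i = exc_record s i && ~~ exc_record s i.+1.
Proof.
rewrite exc_recordE /descent2; case: (boolP (record s i)) => rec; rewrite ?andbF //= andbT.
apply/existsP/andP => [[j /andP[/eqP ji sji]]|[si nrec]].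
  split; last first.
    rewrite -ji exc_recordE negb_and; apply/orP; left.
    by apply/forallPn; exists i; rewrite ji ltnSn /= -leqNgt ltnW.
  (* The first [i + 2] positions have values at most [s i], hence [i < s i] by counting. *)
  rewrite -ltnS; apply: (@perm_prefix_bound _ s i.+2); rewrite -?ji ?ltn_ord // => k.
  rewrite ltnS leq_eqVlt => /predU1P[/val_inj -> |]; first exact: ltnW.
  rewrite ji ltnS leq_eqVlt => /predU1P[/val_inj -> //|ki].
  by apply: ltnW; move/forallP/(_ k)/implyP: rec; apply.
have jn : i.+1 < n by apply: leq_ltn_trans si (ltn_ord _).
exists (Ordinal jn); rewrite eqxx /= ltnNge leq_eqVlt; apply: contra nrec.
case/predU1P => [/val_inj/perm_inj/(congr1 val)/= |sij]; first by lia.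
apply/existsP; exists (Ordinal jn); rewrite eqxx /= (leq_ltn_trans si) // andbT.
apply/forallP => k; apply/implyP; rewrite ltnS leq_eqVlt => /predU1P[/val_inj -> //|ki].
by apply: ltn_trans sij; move/forallP/(_ k)/implyP: rec; apply.
Qed.

(** The smallest element of a pure cycle is where a reading from right to left completes it. *)
Definition closing s i : bool := (s i != i) && [forall y in porbit s i, (y == i) || (i < y)].

Lemma pcyc_closing s : pcyc s = #|[set i | closing s i]|.
Proof.
rewrite /pcyc (card_pure_cycles s (f := fun y : 'I_n => n - y)) => [|a b e].
  apply: eq_card => i; rewrite !inE; congr andb; apply: eq_forallb => y.
  by congr (_ ==> (_ || _)); apply/idP/idP; move: (ltn_ord i) (ltn_ord y); lia.
by apply: val_inj => /=; move: (ltn_ord a) (ltn_ord b); lia.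
Qed.

Lemma closing_gt s i : closing s i -> i < s i /\ i < (s^-1)%g i.
Proof.
case/andP=> si /forall_inP h; split.
  by have := h (s i); rewrite -{1}(expg1 s) mem_porbit (negPf si) => /(_ isT).
have := h ((s^-1)%g i); rewrite -porbitV -{1}(expg1 s^-1) mem_porbit => /(_ isT).
by case/predU1P => // e; rewrite -{1}e permKV eqxx in si.
Qed.

Lemma closing_path_end s i : i < s i ->
  closing s i = ((s^-1)%g i == path_end s (fun y : 'I_n => i < y) i).
Proof.
move=> si; rewrite (canF_eq (permKV s)) eq_sym.
rewrite (path_end_cycle s (A := fun y : 'I_n => i < y)) ?ltnn // /closing.
by case: eqVneq => // e; rewrite e ltnn in si.
Qed.

End ExcRecord.

(** * Partially revealed permutations and their open positions and values *)

Section Corners.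
Variable n : nat.
Implicit Types (s : 'S_n) (i j v w : 'I_n) (E : rel 'I_n) (P : pred 'I_n).

(* [s] restricted to positions >= p and values >= q is given by [E]; [E] is irrelevant elsewhere. *)
Definition corner p q E s : bool :=
  [forall i : 'I_n, forall v : 'I_n, (p <= i) ==> (q <= v) ==> ((s i == v) == E i v)].

Lemma cornerP p q E s :
  reflect (forall i v, p <= i -> q <= v -> (s i == v) = E i v) (corner p q E s).
Proof.
apply: (iffP 'forall_forallP) => h i v; first by move=> pi qv; move: (h i v); rewrite pi qv => /eqP.
by apply/implyP => pi; apply/implyP => qv; rewrite h.
Qed.

Definition free_pos p q E : {set 'I_n} :=
  [set i : 'I_n | (p <= i) && [forall v : 'I_n, (q <= v) ==> ~~ E i v]].
Definition free_val p q E : {set 'I_n} :=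
  [set v : 'I_n | (q <= v) && [forall i : 'I_n, (p <= i) ==> ~~ E i v]].
Definition single_valued p q E :=
  forall i v w, p <= i -> q <= v -> q <= w -> E i v -> E i w -> v = w.

Lemma free_posP p q E i :
  reflect (p <= i /\ forall v, q <= v -> E i v = false) (i \in free_pos p q E).
Proof.
rewrite inE; apply: (iffP andP) => [[pi /forallP h]|[pi h]]; split=> //.
  by move=> v qv; apply/negbTE; apply: (implyP (h v)).
by apply/forallP => v; apply/implyP => /h ->.
Qed.

Lemma free_valP p q E v :
  reflect (q <= v /\ forall i, p <= i -> E i v = false) (v \in free_val p q E).
Proof.
rewrite inE; apply: (iffP andP) => [[pi /forallP h]|[pi h]]; split=> //.
  by move=> i qv; apply/negbTE; apply: (implyP (h i)).
by apply/forallP => i; apply/implyP => /h ->.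
Qed.

Lemma corner_free_pos p q E s i : corner p q E s -> (i \in free_pos p q E) = (p <= i) && (s i < q).
Proof.
move/cornerP=> h; apply/free_posP/andP => [[pi f]|[pi si]]; split=> //.
  by rewrite ltnNge; apply/negP => qs; move: (h i (s i) pi qs); rewrite f ?eqxx.
by move=> v qv; rewrite -h //; apply: contraTF si => /eqP ->; rewrite -leqNgt.
Qed.

Lemma corner_free_val p q E s v :
  corner p q E s -> (v \in free_val p q E) = (q <= v) && ((s^-1)%g v < p).
Proof.
move/cornerP=> h; apply/free_valP/andP => [[qv f]|[qv sv]]; split=> //.
  by rewrite ltnNge; apply/negP => ps; move: (h _ v ps qv); rewrite permKV f ?eqxx.
by move=> i pi; rewrite -h //; apply: contraTF sv => /eqP <-; rewrite permK -leqNgt.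
Qed.

(** Reveals position [i]: [P] is [pred0] when its value lies below the corner and [pred1 w] when it
    is [w]. [set_col] does the same for the value [i]. *)
Definition set_row i P E : rel 'I_n := fun j v => if j == i then P v else E j v.
Definition set_col i P E : rel 'I_n := fun j v => if v == i then P j else E j v.

Lemma corner_set_row i q P E s :
  corner i q (set_row i P E) s =
  corner i.+1 q E s && [forall v : 'I_n, (q <= v) ==> ((s i == v) == P v)].
Proof.
apply/cornerP/andP => [h|[/cornerP h /forallP h'] j v].
  split; last by apply/forallP => v; apply/implyP => qv; rewrite h // /set_row eqxx.
  apply/cornerP => j v ij qv; rewrite h //; last exact: ltnW.
  by rewrite /set_row; have [e|//] := eqVneq j i; rewrite e ltnn in ij.
rewrite leq_eqVlt => /predU1P[/val_inj <-|ij] qv; rewrite /set_row.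
  by rewrite eqxx; exact: (eqP (implyP (h' v) qv)).
by have [e|_] := eqVneq j i; [rewrite e ltnn in ij | apply: h].
Qed.

Lemma corner_set_col i p P E s :
  corner p i (set_col i P E) s =
  corner p i.+1 E s && [forall j : 'I_n, (p <= j) ==> ((s j == i) == P j)].
Proof.
apply/cornerP/andP => [h|[/cornerP h /forallP h'] j v].
  split; last by apply/forallP => j; apply/implyP => pj; rewrite h // /set_col eqxx.
  apply/cornerP => j v pj iv; rewrite h //; last exact: ltnW.
  by rewrite /set_col; have [e|//] := eqVneq v i; rewrite e ltnn in iv.
move=> pj; rewrite leq_eqVlt => /predU1P[/val_inj <-|iv]; rewrite /set_col.
  by rewrite eqxx; exact: (eqP (implyP (h' j) pj)).
by have [e|_] := eqVneq v i; [rewrite e ltnn in iv | apply: h].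
Qed.

Lemma corner_row0 i q E s :
  corner i q (set_row i pred0 E) s = corner i.+1 q E s && (s i < q).
Proof.
rewrite corner_set_row; congr andb; apply/forallP/idP => [h|si v].
  by rewrite ltnNge; apply/negP => qs; move: (implyP (h (s i)) qs); rewrite eqxx.
by apply/implyP => qv /=; rewrite eqbF_neg; apply: contraTneq si => ->; rewrite -leqNgt.
Qed.

Lemma corner_row1 i q w E s : q <= w ->
  corner i q (set_row i (pred1 w) E) s = corner i.+1 q E s && (s i == w).
Proof.
move=> qw; rewrite corner_set_row; congr andb; apply/forallP/eqP => [h|<- v].
  by move: (implyP (h w) qw); rewrite /= eqxx => /eqP/eqP.
by rewrite /= [v == _]eq_sym eqxx implybT.
Qed.

Lemma corner_col0 i p E s :
  corner p i (set_col i pred0 E) s = corner p i.+1 E s && ((s^-1)%g i < p).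
Proof.
rewrite corner_set_col; congr andb; apply/forallP/idP => [h|si j].
  by rewrite ltnNge; apply/negP => ps; move: (implyP (h _) ps); rewrite permKV eqxx.
by apply/implyP => pj /=; rewrite eqbF_neg; apply: contraTneq si => <-; rewrite permK -leqNgt.
Qed.

Lemma corner_col1 i p j E s : p <= j ->
  corner p i (set_col i (pred1 j) E) s = corner p i.+1 E s && (s j == i).
Proof.
move=> pj; rewrite corner_set_col; congr andb; apply/forallP/eqP => [h|<- k].
  by move: (implyP (h j) pj); rewrite /= eqxx => /eqP/eqP.
by rewrite /= (inj_eq perm_inj) eqxx implybT.
Qed.

Lemma row0_free i E :
  free_pos i i.+1 (set_row i pred0 E) = i |: free_pos i.+1 i.+1 E /\
  free_val i i.+1 (set_row i pred0 E) = free_val i.+1 i.+1 E.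
Proof.
split; apply/setP => j.
  rewrite in_setU1; have [->|ji] := eqVneq j i.
    by apply/free_posP; split=> // v _; rewrite /set_row eqxx.
  rewrite !inE /set_row (negPf ji) [RHS]/= ltn_neqAle eq_sym; congr andb.
  by rewrite (inj_eq val_inj) ji.
rewrite !inE; congr andb; apply: eq_forallb => k; rewrite /set_row.
have [->|ki] := eqVneq k i; first by rewrite ltnn implybT.
by rewrite [i < k]ltn_neqAle eq_sym (inj_eq val_inj) ki.
Qed.

Lemma row1_free i w E : w \in free_val i.+1 i.+1 E ->
  free_pos i i.+1 (set_row i (pred1 w) E) = free_pos i.+1 i.+1 E /\
  free_val i i.+1 (set_row i (pred1 w) E) = free_val i.+1 i.+1 E :\ w.
Proof.
move=> /free_valP[iw wf]; split; apply/setP => j.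
  have [->|ji] := eqVneq j i.
    rewrite [RHS]inE ltnn; apply/negbTE/negP => /free_posP[_ /(_ w iw)].
    by rewrite /set_row eqxx /= eqxx.
  by rewrite !inE /set_row (negPf ji) [i < j]ltn_neqAle eq_sym (inj_eq val_inj) ji.
rewrite in_setD1 andbC; apply/free_valP/andP => [[ij h]|[/free_valP[ij h] jw]].
  split; last by have := h i (leqnn i); rewrite /set_row eqxx /= => ->.
  apply/free_valP; split=> // k ik; rewrite -(h k (ltnW ik)) /set_row.
  by have [e|//] := eqVneq k i; rewrite e ltnn in ik.
split=> // k ik; rewrite /set_row; have [_|ki] := eqVneq k i; first exact: negbTE.
by apply: h; rewrite ltn_neqAle ik andbT eq_sym (inj_eq val_inj).
Qed.

Lemma col0_free i E :
  free_pos i i (set_col i pred0 E) = free_pos i i.+1 E /\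
  free_val i i (set_col i pred0 E) = i |: free_val i i.+1 E.
Proof.
split; apply/setP => j; last first.
  rewrite in_setU1; have [->|ji] := eqVneq j i.
    by apply/free_valP; split=> // v _; rewrite /set_col eqxx.
  by rewrite !inE /set_col (negPf ji) [RHS]/= ltn_neqAle [_ == _ :> nat]eq_sym (inj_eq val_inj) ji.
rewrite !inE; congr andb; apply: eq_forallb => k; rewrite /set_col.
have [->|ki] := eqVneq k i; first by rewrite ltnn implybT.
by rewrite [i < k]ltn_neqAle eq_sym (inj_eq val_inj) ki.
Qed.

Lemma col1_free i k E : k \in free_pos i i.+1 E ->
  free_pos i i (set_col i (pred1 k) E) = free_pos i i.+1 E :\ k /\
  free_val i i (set_col i (pred1 k) E) = free_val i i.+1 E.
Proof.
move=> /free_posP[ik kf]; split; apply/setP => j; last first.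
  have [->|ji] := eqVneq j i.
    rewrite [RHS]inE ltnn; apply/negbTE/negP => /free_valP[_ /(_ k ik)].
    by rewrite /set_col eqxx /= eqxx.
  by rewrite !inE /set_col (negPf ji) [i < j]ltn_neqAle eq_sym (inj_eq val_inj) ji.
rewrite in_setD1 andbC; apply/free_posP/andP => [[ij h]|[/free_posP[ij h] jk]].
  split; last by have := h i (leqnn i); rewrite /set_col eqxx /= => ->.
  apply/free_posP; split=> // v iv; rewrite -(h v (ltnW iv)) /set_col.
  by have [e|//] := eqVneq v i; rewrite e ltnn in iv.
split=> // v iv; rewrite /set_col; have [_|vi] := eqVneq v i; first exact: negbTE.
by apply: h; rewrite ltn_neqAle iv andbT eq_sym (inj_eq val_inj).
Qed.

Lemma set_row_single_valued i P E : (forall v w, P v -> P w -> v = w) ->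
  single_valued i.+1 i.+1 E -> single_valued i i.+1 (set_row i P E).
Proof.
move=> hP hE j v w ij iv iw; rewrite /set_row; have [_|ji] := eqVneq j i; first exact: hP.
by apply: hE => //; rewrite ltn_neqAle ij andbT eq_sym (inj_eq val_inj).
Qed.

Lemma set_col_single_valued i P E : (forall j, P j -> j \in free_pos i i.+1 E) ->
  single_valued i i.+1 E -> single_valued i i (set_col i P E).
Proof.
move=> hP hE j v w ij; rewrite /set_col.
have gt (u : 'I_n) : i <= u -> u != i -> i < u.
  by move=> iu ui; rewrite ltn_neqAle iu andbT eq_sym (inj_eq val_inj).
have [->|vi] := eqVneq v i; have [->|wi] := eqVneq w i => // iv iw.
- by move/hP/free_posP=> [_ ->] //; apply: gt.
- by move=> + /hP/free_posP[_ h]; rewrite h //; apply: gt.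
- by apply: hE => //; apply: gt.
Qed.

End Corners.

(** * Summing the weights over the completions of a corner *)

Section CornerSums.
Local Open Scope ring_scope.
Variables (n : nat) (R : comNzRingType) (x t : R).
Implicit Types (s : 'S_n) (i j v w : 'I_n) (E : rel 'I_n).

Definition low_weight s i : R :=
  (if exc_record s i && ~~ exc_record s i.+1 then x else 1) * (if closing s i then t else 1).

Definition low_prod (m : nat) s : R := \prod_(i : 'I_n | (i < m)%N) low_weight s i.

Lemma low_prodS i s : low_prod i.+1 s = low_weight s i * low_prod i s.
Proof.
rewrite /low_prod (bigD1 i) //=; congr (_ * _); apply: eq_bigl => j.
by rewrite ltnS [(j < i)%N]ltn_neqAle andbC.
Qed.

Lemma des2_pcyc_low_prod s : x ^+ des2 s * t ^+ pcyc s = low_prod n s.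
Proof.
rewrite /low_prod (eq_bigl xpredT) => [|i]; last by rewrite ltn_ord.
rewrite big_split /= -!big_mkcond !prodr_const pcyc_closing.
by congr (_ ^+ _ * _ ^+ _); apply: eq_card => i; rewrite !inE // descent2E.
Qed.

Lemma sum_corner_row i E (F : 'S_n -> R) :
  \sum_(s | corner i.+1 i.+1 E s) F s =
  \sum_(s | corner i i.+1 (set_row i pred0 E) s) F s +
  \sum_(w in free_val i.+1 i.+1 E) \sum_(s | corner i i.+1 (set_row i (pred1 w) E) s) F s.
Proof.
rewrite (bigID (fun s : 'S_n => (s i < i.+1)%N)) /=; congr (_ + _).
  by apply: eq_bigl => s; rewrite corner_row0.
rewrite (partition_big (fun s => s i) (mem (free_val i.+1 i.+1 E))) /=; last first.
  by move=> s /andP[cs si]; rewrite (corner_free_val _ cs) permK leqnn andbT ltnNge.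
apply: eq_bigr => w; rewrite inE => /andP[iw _]; apply: eq_bigl => s.
rewrite corner_row1 // -andbA; congr andb.
by case: eqVneq => [->|_]; rewrite ?andbF // -leqNgt iw.
Qed.

Lemma sum_corner_col i E (F : 'S_n -> R) :
  \sum_(s | corner i i.+1 E s) F s =
  \sum_(s | corner i i (set_col i pred0 E) s) F s +
  \sum_(j in free_pos i i.+1 E) \sum_(s | corner i i (set_col i (pred1 j) E) s) F s.
Proof.
rewrite (bigID (fun s : 'S_n => ((s^-1)%g i < i)%N)) /=; congr (_ + _).
  by apply: eq_bigl => s; rewrite corner_col0.
rewrite (partition_big (fun s : 'S_n => (s^-1)%g i) (mem (free_pos i i.+1 E))) /=; last first.
  by move=> s /andP[cs si]; rewrite (corner_free_pos _ cs) permKV leqnn andbT leqNgt.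
apply: eq_bigr => j; rewrite inE => /andP[ij _]; apply: eq_bigl => s.
rewrite corner_col1 // -andbA (canF_eq (permKV s)) [i == _]eq_sym; congr andb.
by case: eqVneq => [e|_]; rewrite ?andbF // -{1}e permK -leqNgt ij.
Qed.

(** The induction statement: a corner influences the total weight of its completions only through
    the common number [k] of open positions and open values and the bit [b]. *)
Definition corner_sum_spec (m : nat) := forall E k b,
  single_valued m m E -> #|free_pos m m E| = k -> #|free_val m m E| = k ->
  (forall s, corner m m E s -> exc_record s m = b) ->
  \sum_(s | corner m m E s) low_prod m s = trans_count x t b k m.

(** With nothing open, [E] is a function that is onto, hence a single permutation; an open position
    would need a value below 0. *)
Lemma corner_sum0 : corner_sum_spec 0.
Proof.
move=> E [|k] b sv cp cv _ /=; last first.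
  have /card_gt0P[i /free_posP[_ hi]] : (0 < #|free_pos 0 0 E|)%N by rewrite cp.
  rewrite big_pred0 // => s; apply/cornerP => /(_ i (s i) isT isT).
  by rewrite eqxx hi.
have ex i : exists v, E i v.
  apply/existsP; apply: contraT; rewrite negb_exists => /forallP h.
  have : i \in free_pos 0 0 E by apply/free_posP; split=> // v _; apply/negbTE/h.
  by rewrite (cards0_eq cp) inE.
pose f i := xchoose (ex i); have fE i : E i (f i) by apply: xchooseP.
have f_inj : injective f.
  suff onto : codom f =i predT by apply/injectiveP/card_uniqP; rewrite (eq_card onto) size_codom.
  move=> v; rewrite [RHS]inE; apply: contraT => vf.
  suff : v \in free_val 0 0 E by rewrite (cards0_eq cv) inE.
  apply/free_valP; split=> // i _; apply: contraNF vf => Ev; apply/codomP; exists i.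
  exact: (sv i).
rewrite (big_pred1 (perm f_inj)) => [|s].
  by rewrite /low_prod big_pred0.
apply/cornerP/eqP => [h|-> i v _ _]; last first.
  by rewrite permE; apply/eqP/idP => [<- //|Ev]; apply: (sv i).
by apply/permP => i; rewrite permE; apply/eqP; rewrite h.
Qed.

(** Reveals where the value [i] sits, once position [i] is treated; until then there is one more
    open position than open values. The weight [tau] is 1 if the value [i] stays open and [c j] if
    it sits at [j]. *)
Lemma corner_sum_cols i E k b (tau : 'S_n -> R) (c : 'I_n -> R) : corner_sum_spec i ->
  single_valued i i.+1 E -> #|free_pos i i.+1 E| = k.+1 -> #|free_val i i.+1 E| = k ->
  (forall s, corner i i.+1 E s -> exc_record s i = b) ->
  (forall s, corner i i.+1 E s -> ((s^-1)%g i < i)%N -> tau s = 1) ->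
  (forall s j, corner i i.+1 E s -> s j = i -> tau s = c j) ->
  \sum_(s | corner i i.+1 E s) tau s * low_prod i s =
  trans_count x t b k.+1 i + (\sum_(j in free_pos i i.+1 E) c j) * trans_count x t b k i.
Proof.
move=> IH sv cp cv eb tau1 tauc; rewrite sum_corner_col; congr (_ + _).
  have [fp fv] := col0_free i E.
  rewrite -(IH (set_col i pred0 E) k.+1 b); last 4 first.
  - exact: set_col_single_valued.
  - by rewrite fp.
  - rewrite fv cardsU1 cv; case: free_valP => [[]|//]; by rewrite ltnn.
  - by move=> s; rewrite corner_col0 => /andP[/eb].
  by apply: eq_bigr => s; rewrite corner_col0 => /andP[cs si]; rewrite tau1 ?mul1r.
rewrite mulr_suml; apply: eq_bigr => j jf.
have ij : (i <= j)%N by case/free_posP: (jf).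
have [fp fv] := col1_free jf.
rewrite -(IH (set_col i (pred1 j) E) k b); last 4 first.
- by apply: set_col_single_valued => // j' /eqP ->.
- by rewrite fp; move: (cardsD1 j (free_pos i i.+1 E)); rewrite jf cp => -[].
- by rewrite fv.
- by move=> s; rewrite corner_col1 // => /andP[/eb].
rewrite mulr_sumr; apply: eq_bigr => s; rewrite corner_col1 // => /andP[cs /eqP sj].
by rewrite (tauc s j).
Qed.

(** The walk from [i] uses only positions at least [i] and values above [i], where [E] fixes the
    permutation. *)
Lemma corner_path_end i E s s' : corner i i.+1 E s -> corner i i.+1 E s' ->
  path_end s' (fun y : 'I_n => (i < y)%N) i = path_end s (fun y : 'I_n => (i < y)%N) i.
Proof.
move=> /cornerP cs /cornerP cs'; rewrite /path_end.
elim: #|_| => //= k ->; set y := iter k _ _.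
have iy : (i <= y)%N.
  by rewrite /y; elim: (k) => //= k' IH; case: ifP => // /ltnW.
case: ifP => h; last first.
  case: ifP => // h'; have := cs y (s y) iy h'; rewrite eqxx -cs' // => /esym/eqP e.
  by rewrite e h' in h.
have /esym/eqP := cs' y (s' y) iy h; rewrite -cs // eqxx => /eqP/eqP e.
by rewrite e h.
Qed.

(** The open values are [w] and the values above [i] taken left of [i], so [i] is a record exactly
    when [w] is the largest of them. *)
Lemma corner_exc_record i E w s : w \in free_val i.+1 i.+1 E ->
  corner i.+1 i.+1 E s -> s i = w ->
  exc_record s i = [forall v in free_val i.+1 i.+1 E, (v <= w)%N].
Proof.
move=> wf cs si; rewrite exc_recordE si.
have iw : (i < w)%N by case/free_valP: wf.
rewrite iw andbT; apply/forallP/forall_inP => [rec v|h j].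
  rewrite (corner_free_val _ cs) ltnS => /andP[_]; rewrite leq_eqVlt => /predU1P[/val_inj e|].
    by rewrite -si -e permKV.
  by move/(implyP (rec _)); rewrite permKV si => /ltnW.
apply/implyP => ji; rewrite si; case: (leqP (s j) i) => [sj|sj]; first exact: leq_ltn_trans iw.
rewrite ltn_neqAle h ?andbT; last by rewrite (corner_free_val _ cs) permK sj ltnW.
by apply: contraTneq ji => /val_inj; rewrite -si => /perm_inj ->; rewrite ltnn.
Qed.

Lemma sum_marked (T : finType) (A : {set T}) e k (a : R) : e \in A -> #|A| = k.+1 ->
  \sum_(j in A) (if j == e then a else 1) = k%:R + a.
Proof.
move=> eA cA; rewrite (bigD1 e) //= eqxx addrC; congr (_ + _).
rewrite (eq_bigr (fun=> 1)) => [|j /andP[_ /negPf ->]//].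
rewrite sumr_const; congr (_ *+ _); move: (cardsD1 e A); rewrite eA cA => -[->].
by apply: eq_card => j; rewrite !inE unfold_in andbC.
Qed.

Lemma corner_sum_closing i E k b : corner_sum_spec i ->
  single_valued i i.+1 E -> #|free_pos i i.+1 E| = k.+1 -> #|free_val i i.+1 E| = k ->
  (forall s, corner i i.+1 E s -> exc_record s i = b) ->
  (forall s, corner i i.+1 E s -> (i < s i)%N) ->
  \sum_(s | corner i i.+1 E s) (if closing s i then t else 1) * low_prod i s =
  trans_count x t b k.+1 i + (k%:R + t) * trans_count x t b k i.
Proof.
move=> IH sv cp cv eb up.
have no_closing s : ((s^-1)%g i < i)%N -> (if closing s i then t else 1) = 1 :> R.
  by case: ifP => // /closing_gt[_ gt lt]; move: (ltn_trans gt lt); rewrite ltnn.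
(* The value [i] closes a cycle only at [e], the end of the walk from [i], which is an open
   position; if the corner has no completion, any open position serves as [e]. *)
have [e ef ee] : exists2 e, e \in free_pos i i.+1 E &
    forall s, corner i i.+1 E s -> path_end s (fun y : 'I_n => (i < y)%N) i = e.
  have [s0 cs0|none] := pickP (corner i i.+1 E); last first.
    have /card_gt0P[e ef] : (0 < #|free_pos i i.+1 E|)%N by rewrite cp.
    by exists e => // s; rewrite none.
  exists (path_end s0 (fun y : 'I_n => (i < y)%N) i) => [|s]; last exact: corner_path_end.
  have [|d [ed eend dpath]] := @path_endP _ s0 (fun y : 'I_n => (i < y)%N) i; first by rewrite ltnn.
  rewrite (corner_free_pos _ cs0) ltnS [X in _ && X]leqNgt eend andbT ed.
  by case: d {ed} dpath => // d /(_ d.+1); rewrite leqnn => /(_ isT)/ltnW.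
rewrite (@corner_sum_cols i E k b _ (fun j => if j == e then t else 1)) //.
- by rewrite (sum_marked _ ef cp).
- by move=> s _; apply: no_closing.
move=> s j cs sj; rewrite closing_path_end ?up // ee //.
by rewrite -sj permK.
Qed.

Lemma corner_sum m : (m <= n)%N -> corner_sum_spec m.
Proof.
elim: m => [_|m IH mn]; first exact: corner_sum0.
have {}IH := IH (ltnW mn); have [i im] : exists i : 'I_n, i = m :> nat by exists (Ordinal mn).
rewrite -{}im {m mn} in IH * => E k b sv cp cv eb.
have [fp0 fv0] := row0_free i E.
have sum0 : \sum_(s | corner i i.+1 (set_row i pred0 E) s) low_prod i.+1 s =
    trans_count x t false k.+1 i + k.+1%:R * trans_count x t false k i.
  under eq_bigr do rewrite low_prodS.
  have weight1 s : (s i < i.+1)%N -> low_weight s i = 1.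
    rewrite ltnS leqNgt => /negPf si; rewrite /low_weight exc_recordE si andbF mul1r.
    by case: ifP => // /closing_gt[]; rewrite si.
  have fp : #|free_pos i i.+1 (set_row i pred0 E)| = k.+1.
    by rewrite fp0 cardsU1 cp; case: free_posP => [[]|//]; rewrite ltnn.
  rewrite (@corner_sum_cols i _ k false _ (fun=> 1)) ?fv0 //.
  - by rewrite sumr_const fp.
  - exact: set_row_single_valued.
  - by move=> s; rewrite corner_row0 ltnS leqNgt exc_recordE => /andP[_ /negPf ->]; rewrite andbF.
  - by move=> s; rewrite corner_row0 => /andP[_ /weight1].
  - by move=> s j; rewrite corner_row0 => /andP[_ /weight1].
rewrite sum_corner_row {}sum0 /=; congr (_ + _).
case: k cp cv => [|k] cp cv; first by rewrite (cards0_eq cv) big_set0.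
(* Only the largest of the [k + 1] open values makes [i] an excedance record: it sets the bit, with
   weight [x] if [b] is false. The other [k] values clear the bit. *)
pose top w := [forall v in free_val i.+1 i.+1 E, (v <= w)%N].
have row w : w \in free_val i.+1 i.+1 E ->
    \sum_(s | corner i i.+1 (set_row i (pred1 w) E) s) low_prod i.+1 s =
    (if top w && ~~ b then x else 1) *
    (trans_count x t (top w) k.+1 i + (k%:R + t) * trans_count x t (top w) k i).
  move=> wf; have [fp fv] := row1_free wf.
  have iw : (i < w)%N by case/free_valP: wf.
  rewrite -(@corner_sum_closing i (set_row i (pred1 w) E)) //.
  - rewrite mulr_sumr; apply: eq_bigr => s; rewrite corner_row1 // => /andP[cs /eqP si].
    by rewrite low_prodS mulrA /low_weight (corner_exc_record wf cs si) (eb s cs).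
  - by apply: set_row_single_valued => // v u /eqP -> /eqP ->.
  - by rewrite fp.
  - by rewrite fv; move: (cardsD1 w (free_val i.+1 i.+1 E)); rewrite wf cv => -[].
  - by move=> s; rewrite corner_row1 // => /andP[cs /eqP si]; apply: corner_exc_record si.
  - by move=> s; rewrite corner_row1 // => /andP[_ /eqP ->].
rewrite (eq_bigr _ row).
have /card_gt0P[w0 w0f] : (0 < #|free_val i.+1 i.+1 E|)%N by rewrite cv.
have [w wf0 wmax] := arg_maxnP (fun v : 'I_n => v : nat) w0f.
have {wf0}wf : w \in free_val i.+1 i.+1 E := wf0.
have topE v : v \in free_val i.+1 i.+1 E -> top v = (v == w).
  move=> vf; apply/forall_inP/eqP => [h|-> u /wmax //].
  by apply/val_inj/anti_leq; rewrite h // andbT; apply: wmax.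
rewrite (bigD1 w) //= topE // eqxx /=; congr (_ + _); first by case: b {eb row}.
rewrite (eq_bigr (fun=> trans_count x t false k.+1 i + (k%:R + t) * trans_count x t false k i)); last first.
  by move=> v /andP[vf vw]; rewrite topE // (negPf vw) mul1r.
rewrite sumr_const [RHS]mulr_natl; congr (_ *+ _).
move: (cardsD1 w (free_val i.+1 i.+1 E)); rewrite wf cv => -[->].
by apply: eq_card => v; rewrite !inE andbC unfold_in inE.
Qed.

Lemma sum_des2_pcyc : \sum_(s : 'S_n) x ^+ des2 s * t ^+ pcyc s = trans_count x t true 0 n.
Proof.
have none p (i : 'I_n) : (n <= i)%N && p = false by rewrite leqNgt ltn_ord.
(* The corner at [n] is empty and its bit is false; at level 0 both bits give the same count. *)
have <- : trans_count x t false 0 n = trans_count x t true 0 n by case: (n).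
rewrite -(corner_sum (leqnn n) (E := fun _ _ => false)).
- apply: eq_big => [s|s _]; last exact: des2_pcyc_low_prod.
  by apply/esym/cornerP => i v; rewrite leqNgt ltn_ord.
- by move=> i v w; rewrite leqNgt ltn_ord.
- by apply: eq_card0 => i; rewrite inE none.
- by apply: eq_card0 => i; rewrite inE none.
- by move=> s _; apply: exc_record_last.
Qed.

End CornerSums.

Theorem theorem1p5 (n : nat) (hn : (1 <= n)%N) :
  [/\ bistat_poly (@des2 n) (@ear n) = bistat_poly (@ear n) (@des2 n),
      bistat_poly (@des2 n) (@ear n) = bistat_poly (@des2 n) (@pdrop n),
      bistat_poly (@des2 n) (@ear n) = bistat_poly (@pdrop n) (@des2 n),
      bistat_poly (@des2 n) (@ear n) = bistat_poly (@des2 n) (@pcyc n) &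
      bistat_poly (@des2 n) (@ear n) = bistat_poly (@pcyc n) (@des2 n)].
Proof.
pose S (u v : {poly {poly int}}) st := (\sum_(s : 'S_n) u ^+ des2 s * v ^+ st s)%R.
(* The right-to-left recurrence evaluates the sum for [pcyc]; [ear] and [pdrop] follow, being [hits]
   of other admissible choices. *)
have value u v st : [\/ st = @ear n, st = @pdrop n | st = @pcyc n] ->
    S u v st = trans_count u v true 0 n.
  have pcyc_value : S u v (@pcyc n) = trans_count u v true 0 n by apply: sum_des2_pcyc.
  have indep c : admissible c ->
      (\sum_(s : 'S_n) u ^+ des2 s * v ^+ hits c s)%R = trans_count u v true 0 n.
    move=> /(des2_hits_indep u v (@closing_admissible n)) <-.
    by rewrite -pcyc_value; apply: eq_bigr => s _; rewrite pcyc_hits.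
  case=> -> //.
    rewrite -(indep (extremal_choice leq)); last first.
      exact: extremal_admissible leqnn leq_trans leq_total.
    by apply: eq_bigr => s _; rewrite ear_hits.
  rewrite -(indep (extremal_choice geq)); last first.
    exact: extremal_admissible geq_refl geq_trans geq_total.
  by apply: eq_bigr => s _; rewrite pdrop_hits.
(* Exchanging the two statistics amounts to exchanging q and t. *)
have swap st : bistat_poly st (@des2 n) = S 'X%R 'X%:P%R st.
  by apply: eq_bigr => s _; rewrite mulrC.
have sym u v : trans_count u v true 0 n = trans_count v u true 0 n :> {poly {poly int}}.
  (* At level 0 the factor [rising] is an empty product, so the symmetry of [path_count] carries
     over. *)
  by rewrite !trans_count_scale path_count_sym /rising !big_ord0.
have direct st : bistat_poly (@des2 n) st = S 'X%:P%R 'X%R st by [].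
rewrite !swap !direct !value; try by [constructor 1 | constructor 2 | constructor 3].
Qed.
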